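(* Let $(\mathcal{A},\mathcal{B},E,E')$ be an operator-valued infinitesimal (OVI) probability space, let $(\widetilde{\mathcal{A}},\widetilde{\mathcal{B}},\widetilde{E})$ be its upper triangular probability space, and let $(\mathcal{A}_i)_{i\in I}$ be a family of subalgebras of $\mathcal{A}$, each containing $\mathcal{B}$. For each $i\in I$ set $$\widetilde{\mathcal{A}}_i=\left\{\begin{bmatrix} a & a'\\ 0 & a\end{bmatrix} : a,a'\in\mathcal{A}_i\right\}.$$ Then $(\mathcal{A}_i)_{i\in I}$ are infinitesimally free with respect to $(E,E')$ if and only if $(\widetilde{\mathcal{A}}_i)_{i\in I}$ are free with respect to $\widetilde{E}$ (over $\widetilde{\mathcal{B}}$).
   Context: All algebras are over $\mathbb{C}$. An operator-valued probability space $(\mathcal{A},\mathcal{B},E)$ consists of a unital algebra $\mathcal{A}$, a unital subalgebra $\mathcal{B}\subseteq\mathcal{A}$ and a linear map $E:\mathcal{A}\to\mathcal{B}$ with $E(b)=b$ and $E(b_1ab_2)=b_1E(a)b_2$ for all $b,b_1,b_2\in\mathcal{B}$, $a\in\mathcal{A}$ (a conditional expectation). An OVI probability space $(\mathcal{A},\mathcal{B},E,E')$ is an operator-valued probability space $(\mathcal{A},\mathcal{B},E)$ together with a linear map $E':\mathcal{A}\to\mathcal{B}$ such that $E'(1)=0$ and $E'(b_1ab_2)=b_1E'(a)b_2$ for all $b_1,b_2\in\mathcal{B}$, $a\in\mathcal{A}$. Freeness: subalgebras $(\mathcal{A}_i)_{i\in I}$ of $\mathcal{A}$ containing $\mathcal{B}$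 are free with respect to $E$ (over $\mathcal{B}$) if $E(a_1\cdots a_n)=0$ whenever $n\ge 1$, $a_j\in\mathcal{A}_{i_j}$, $i_1\neq i_2\neq\cdots\neq i_n$ (consecutive indices are distinct) and $E(a_j)=0$ for all $j$. Infinitesimal freeness: subalgebras $(\mathcal{A}_i)_{i\in I}$ of $\mathcal{A}$ containing $\mathcal{B}$ are infinitesimally free with respect to $(E,E')$ if for all $n\ge1$, all $i_1,\dots,i_n\in I$ with $i_1\neq i_2\neq\cdots\neq i_n$ (consecutive indices distinct) and all $a_j\in\mathcal{A}_{i_j}$ with $E(a_j)=0$, one has $E(a_1\cdots a_n)=0$ and $E'(a_1\cdots a_n)=\sum_{j=1}^nE(a_1\cdots a_{j-1}E'(a_j)a_{j+1}\cdots a_n)$. The upper triangular probability space of $(\mathcal{A},\mathcal{B},E,E')$ is the operator-valued probability space $(\widetilde{\mathcal{A}},\widetilde{\mathcal{B}},\widetilde{E})$ where $\widetilde{\mathcal{A}}=\left\{\begin{bmatrix} a&a'\\0&a\end{bmatrix}: a,a'\in\mathcal{A}\right\}\subseteq M_2(\mathcal{A})$, $\widetilde{\mathcal{B}}=\left\{\begin{bmatrix} b&b'\\0&b\end{bmatrix}: b,b'\in\mathcal{B}\right\}$ and $\widetilde{E}\left(\begin{bmatrix} a&a'\\0&a\end{bmatrix}\right)=\begin{bmatrix}E(a)&E(a')+E'(a)\\0&E(a)\end{bmatrix}$. *)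

(* Defs.v *)
From HB Require Import structures.
From mathcomp Require Import all_boot all_order all_algebra.
From mathcomp Require Import complex.
From mathcomp Require Import reals.
Set Implicit Arguments.
Unset Strict Implicit.
Unset Printing Implicit Defensive.

Import GRing.Theory.
Local Open Scope ring_scope.

(* The expectation is a map into the ambient algebra whose values lie in the
   base subalgebra, rather than a map into a separate type. *)
Record ovSpace (K : fieldType) := OVSpace {
  ov_alg :> algType K;
  ov_base : subalgClosed ov_alg;
  ov_exp : {linear ov_alg -> ov_alg};
  ov_exp_base : forall a, ov_exp a \in ov_base;
  ov_exp_id : {in ov_base, forall b, ov_exp b = b};
  ov_exp_bimod : {in ov_base &, forall b1 b2, forall a,
    ov_exp (b1 * a * b2) = b1 * ov_exp a * b2} }.

Record oviSpace (K : fieldType) := OVISpace {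
  ovi_ov :> ovSpace K;
  ovi_exp' : {linear ovi_ov -> ovi_ov};
  ovi_exp'_base : forall a, ovi_exp' a \in ov_base ovi_ov;
  ovi_exp'1 : ovi_exp' 1 = 0;
  ovi_exp'_bimod : {in ov_base ovi_ov &, forall b1 b2, forall a,
    ovi_exp' (b1 * a * b2) = b1 * ovi_exp' a * b2} }.

Record subalgOver (K : fieldType) (S : ovSpace K) := SubalgOver {
  subalg_set :> subalgClosed S;
  subalg_over : {subset ov_base S <= subalg_set} }.

Section Freeness.
Variables (K : fieldType) (I : Type).

Definition alternating n (i : 'I_n -> I) : Prop :=
  forall j k : 'I_n, k = j.+1 :> nat -> i j <> i k.

Definition free_family (S : ovSpace K) (Ai : I -> subalgOver S) : Prop :=
  forall (n : nat) (i : 'I_n -> I) (a : 'I_n -> S),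
    (0 < n)%N -> alternating i ->
    (forall j, a j \in subalg_set (Ai (i j))) ->
    (forall j, ov_exp S (a j) = 0) ->
    ov_exp S (\prod_(j < n) a j) = 0.

Definition inf_free_family (S : oviSpace K) (Ai : I -> subalgOver S) : Prop :=
  forall (n : nat) (i : 'I_n -> I) (a : 'I_n -> S),
    (0 < n)%N -> alternating i ->
    (forall j, a j \in subalg_set (Ai (i j))) ->
    (forall j, ov_exp S (a j) = 0) ->
    ov_exp S (\prod_(j < n) a j) = 0 /\
    ovi_exp' S (\prod_(j < n) a j) =
      \sum_(j < n) ov_exp S ((\prod_(k < n | (k < j)%N) a k)
                             * ovi_exp' S (a j)
                             * (\prod_(k < n | (j < k)%N) a k)).

End Freeness.

Section UpperTriangular.
Variables (K : fieldType) (A : algType K).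

Definition ut_pred : pred 'M[A]_2 :=
  fun M => (M 1 0 == 0) && (M 1 1 == M 0 0).

Record utmx := UTMx { utval :> 'M[A]_2; _ : ut_pred utval }.

HB.instance Definition _ := [isSub for utval].
HB.instance Definition _ := [Choice of utmx by <:].

Lemma ut_predP (M : 'M[A]_2) :
  reflect (M 1 0 = 0 /\ M 1 1 = M 0 0) (M \in ut_pred).
Proof. by apply: (iffP andP) => -[/eqP ? /eqP ?]; split. Qed.

Lemma ut_pred_subring : subring_closed ut_pred.
Proof.
split.
- by apply/ut_predP; rewrite !mxE.
- move=> M N /ut_predP [M1 M2] /ut_predP [N1 N2]; apply/ut_predP.
  by rewrite !mxE M1 M2 N1 N2 subrr.
- move=> M N /ut_predP [M1 M2] /ut_predP [N1 N2]; apply/ut_predP.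
  rewrite !mxE !big_ord_recl !big_ord0 /=.
  have -> : lift ord0 ord0 = 1 :> 'I_2 by apply/val_inj.
  by rewrite M1 M2 N1 N2 !mul0r !mulr0 !addr0 !add0r.
Qed.
HB.instance Definition _ := GRing.isSubringClosed.Build _ ut_pred ut_pred_subring.
HB.instance Definition _ := [SubChoice_isSubNzRing of utmx by <:].

Definition ut_diag (M : utmx) : A := utval M 0 0.
Definition ut_corner (M : utmx) : A := utval M 0 1.

Definition ut_raw (a a' : A) : 'M[A]_2 :=
  \matrix_(i, j) if i == j then a else if i == 0 then a' else 0.

Lemma ut_raw_subproof a a' : ut_pred (ut_raw a a').
Proof. by apply/ut_predP; rewrite !mxE. Qed.

Definition ut (a a' : A) : utmx := UTMx (ut_raw_subproof a a').

Lemma ut_diagE a a' : ut_diag (ut a a') = a.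
Proof. by rewrite /ut_diag mxE. Qed.

Lemma ut_cornerE a a' : ut_corner (ut a a') = a'.
Proof. by rewrite /ut_corner mxE. Qed.

Lemma ut_ext (M N : utmx) :
  ut_diag M = ut_diag N -> ut_corner M = ut_corner N -> M = N.
Proof.
move=> d c; apply/val_inj/matrixP.
have [/ut_predP[M1 M2] /ut_predP[N1 N2]] := (valP M, valP N).
move=> i j; have two (k : 'I_2) : k = 0 \/ k = 1.
  by case: k => [[|[|k]] lk] //; [left|right]; apply/val_inj.
by case: (two i) => ->; case: (two j) => ->; rewrite /= ?M1 ?M2 ?N1 ?N2.
Qed.

Lemma ut_eta M : ut (ut_diag M) (ut_corner M) = M.
Proof. by apply: ut_ext; rewrite ?ut_diagE ?ut_cornerE. Qed.

Lemma ut_diagD M N : ut_diag (M + N) = ut_diag M + ut_diag N.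
Proof. by rewrite /ut_diag mxE. Qed.

Lemma ut_cornerD M N : ut_corner (M + N) = ut_corner M + ut_corner N.
Proof. by rewrite /ut_corner mxE. Qed.

Lemma ut_diag1 : ut_diag 1 = 1.
Proof. by rewrite /ut_diag mxE. Qed.

Lemma ut_corner1 : ut_corner 1 = 0.
Proof. by rewrite /ut_corner mxE. Qed.

Lemma ut_diagM M N : ut_diag (M * N) = ut_diag M * ut_diag N.
Proof.
have /ut_predP[N1 N2] := valP N.
rewrite /ut_diag mxE !big_ord_recl !big_ord0 /=.
have -> : lift ord0 ord0 = 1 :> 'I_2 by apply/val_inj.
by rewrite N1 mulr0 !addr0.
Qed.

Lemma ut_cornerM M N :
  ut_corner (M * N) = ut_diag M * ut_corner N + ut_corner M * ut_diag N.
Proof.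
have /ut_predP[N1 N2] := valP N.
rewrite /ut_corner /ut_diag mxE !big_ord_recl !big_ord0 /=.
have -> : lift ord0 ord0 = 1 :> 'I_2 by apply/val_inj.
by rewrite N2 !addr0.
Qed.

Lemma ut_scale_subproof (c : K) (M : utmx) :
  ut_pred (map_mx ( *:%R c) (utval M)).
Proof.
have /ut_predP[M1 M2] := valP M.
by apply/ut_predP; rewrite !mxE M1 M2 scaler0.
Qed.

(* Entrywise scaling by K; the library's scaling on 'M[A]_2 is by A. *)
Definition ut_scale (c : K) (M : utmx) : utmx := UTMx (ut_scale_subproof c M).

Lemma ut_diag_scale c M : ut_diag (ut_scale c M) = c *: ut_diag M.
Proof. by rewrite /ut_diag mxE. Qed.

Lemma ut_corner_scale c M : ut_corner (ut_scale c M) = c *: ut_corner M.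
Proof. by rewrite /ut_corner mxE. Qed.

Definition utE := (ut_diagE, ut_cornerE, ut_diagD, ut_cornerD, ut_diag1,
  ut_corner1, ut_diagM, ut_cornerM, ut_diag_scale, ut_corner_scale).

Fact ut_scaleA c d M : ut_scale c (ut_scale d M) = ut_scale (c * d) M.
Proof. by apply: ut_ext; rewrite !utE scalerA. Qed.
Fact ut_scale1 : left_id 1 ut_scale.
Proof. by move=> M; apply: ut_ext; rewrite !utE scale1r. Qed.
Fact ut_scaleDr : right_distributive ut_scale +%R.
Proof. by move=> c M N; apply: ut_ext; rewrite !utE scalerDr. Qed.
Fact ut_scaleDl M : {morph ut_scale^~ M : c d / c + d}.
Proof. by move=> c d; apply: ut_ext; rewrite !utE scalerDl. Qed.
HB.instance Definition _ :=
  GRing.Zmodule_isLmodule.Build K utmx ut_scaleA ut_scale1 ut_scaleDr ut_scaleDl.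

Fact ut_scaleAl (c : K) (M N : utmx) : c *: (M * N) = (c *: M) * N.
Proof. by apply: ut_ext; rewrite !utE ?scalerDr !scalerAl. Qed.
HB.instance Definition _ := GRing.Lmodule_isLalgebra.Build K utmx ut_scaleAl.

Fact ut_scaleAr (c : K) (M N : utmx) : c *: (M * N) = M * (c *: N).
Proof. by apply: ut_ext; rewrite !utE ?scalerDr !scalerAr. Qed.
HB.instance Definition _ := GRing.Lalgebra_isAlgebra.Build K utmx ut_scaleAr.

Definition ut_over (D : {pred A}) : {pred utmx} :=
  [pred M | (ut_diag M \in D) && (ut_corner M \in D)].

Lemma ut_over_subalg (D : subalgClosed A) : subalg_closed (ut_over D).
Proof.
split.
- by rewrite inE !utE rpred1 rpred0.
- move=> c M N /andP[M1 M2] /andP[N1 N2]; rewrite inE !utE.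
  by rewrite !rpredD ?rpredZ.
- move=> M N /andP[M1 M2] /andP[N1 N2]; rewrite inE !utE.
  by rewrite rpredD ?rpredM.
Qed.
HB.instance Definition _ (D : subalgClosed A) :=
  GRing.isSubalgClosed.Build K utmx (ut_over D) (ut_over_subalg D).

Definition ut_exp (E E' : A -> A) (M : utmx) : utmx :=
  ut (E (ut_diag M)) (E (ut_corner M) + E' (ut_diag M)).

Lemma ut_exp_linear (E E' : {linear A -> A}) : linear (ut_exp E E').
Proof.
move=> c M N; apply: ut_ext; rewrite !utE; first by rewrite linearP.
by rewrite !linearP /= scalerDr addrACA.
Qed.
HB.instance Definition _ (E E' : {linear A -> A}) :=
  GRing.isLinear.Build K utmx utmx *:%R (ut_exp E E') (ut_exp_linear E E').

End UpperTriangular.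

Section UpperTriangularSpace.
Variables (K : fieldType) (S : oviSpace K).

Let B : subalgClosed S := ov_base S.
Let E := ov_exp S.
Let E' := ovi_exp' S.

Lemma ovi_exp'_eq0 : {in B, forall b, E' b = 0}.
Proof.
move=> b bB; have := ovi_exp'_bimod bB (rpred1 B) 1.
by rewrite !mulr1 ovi_exp'1 mulr0.
Qed.

Lemma ut_exp_base (M : utmx S) : ut_exp E E' M \in ut_over B.
Proof. by rewrite inE !utE rpredD ?ov_exp_base ?ovi_exp'_base. Qed.

Lemma ut_exp_id : {in ut_over B, forall M, ut_exp E E' M = M}.
Proof.
move=> M /andP[M1 M2]; apply: ut_ext; rewrite !utE; first exact: ov_exp_id.
by rewrite ovi_exp'_eq0 // addr0; apply: ov_exp_id.
Qed.

Lemma ut_exp_bimod : {in ut_over B &, forall M N, forall X,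
  ut_exp E E' (M * X * N) = M * ut_exp E E' X * N}.
Proof.
move=> M N /andP[M1 M2] /andP[N1 N2] X; apply: ut_ext; rewrite !utE.
  exact: ov_exp_bimod.
rewrite !mulrDl !linearD /= !ov_exp_bimod // ovi_exp'_bimod //.
by rewrite mulrDr mulrDl -!addrA; congr (_ + (_ + _)); rewrite addrC.
Qed.

Definition upper_triangular : ovSpace K :=
  @OVSpace K (utmx S) (ut_over B) (ut_exp E E')
    ut_exp_base ut_exp_id ut_exp_bimod.

Lemma ut_over_base (D : subalgOver S) :
  {subset ov_base upper_triangular <= ut_over D}.
Proof.
by move=> M /andP[M1 M2]; rewrite inE /= !subalg_over.
Qed.

Definition ut_subalg (D : subalgOver S) : subalgOver upper_triangular :=
  @SubalgOver K upper_triangular (ut_over D) (@ut_over_base D).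

End UpperTriangularSpace.

(* Main.v *)
Require Import Defs.
From mathcomp Require Import all_boot all_order all_algebra.
From mathcomp Require Import complex.
From mathcomp Require Import reals.
Import GRing.Theory.
Local Open Scope ring_scope.

(** An upper triangular matrix with diagonal [a] and corner [a'] behaves like
    the first-order jet [a + eps a'], so the corner of a product obeys the
    Leibniz rule ([ut_corner_prod]).  For [M_j = ut a_j a'_j] this says
    that the expectation of [\prod_j M_j] has diagonal [E(\prod_j a_j)]
    and corner
      [\sum_j E(a_1 .. a'_j .. a_n) + E'(a_1 .. a_n)].

    The matrix [M_j] is centered exactly when [E(a_j) = 0] and
    [E(a'_j) + E'(a_j) = 0].  As [E'(a_j)] lies in the base, on which [E] is
    the identity, the second condition says that [c_j := a'_j + E'(a_j)] is
    centered.  If the subalgebras are infinitesimally free, the corner above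
    becomes [\sum_j E(a_1 .. c_j .. a_n)], each term of which is the expectation
    of an alternating product of centered elements and so vanishes.

    Conversely, given centered [a_j], the choice [a'_j := - E'(a_j)] makes [M_j]
    centered and stays in the subalgebra of [a_j], since that contains the base;
    the vanishing of the corner is then the infinitesimal freeness formula. *)

Section SplitProducts.
Variable A : pzRingType.

Lemma prod_before0 n (f : 'I_n.+1 -> A) :
  \prod_(k < n.+1 | (k < (ord0 : 'I_n.+1))%N) f k = 1.
Proof. exact: big_pred0. Qed.

Lemma prod_after0 n (f : 'I_n.+1 -> A) :
  \prod_(k < n.+1 | ((ord0 : 'I_n.+1) < k)%N) f k =
  \prod_(k < n) f (lift ord0 k).
Proof. by rewrite big_mkcond big_ord_recl /= mul1r. Qed.

Lemma prod_before_lift n (f : 'I_n.+1 -> A) (j : 'I_n) :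
  \prod_(k < n.+1 | (k < lift ord0 j)%N) f k =
  f ord0 * \prod_(k < n | (k < j)%N) f (lift ord0 k).
Proof. by rewrite big_mkcond big_ord_recl [in RHS]big_mkcond. Qed.

Lemma prod_after_lift n (f : 'I_n.+1 -> A) (j : 'I_n) :
  \prod_(k < n.+1 | (lift ord0 j < k)%N) f k =
  \prod_(k < n | (j < k)%N) f (lift ord0 k).
Proof. by rewrite big_mkcond big_ord_recl /= mul1r [in RHS]big_mkcond. Qed.

Lemma prod_split_at n (f : 'I_n -> A) (j : 'I_n) :
  \prod_(k < n) f k =
  (\prod_(k < n | (k < j)%N) f k) * f j * \prod_(k < n | (j < k)%N) f k.
Proof.
elim: n => [|n IHn] in f j *; first by case: j.
rewrite big_ord_recl; case: (unliftP ord0 j) => [j'|] ->.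
  by rewrite prod_before_lift prod_after_lift (IHn _ j') !mulrA.
by rewrite prod_before0 prod_after0 mul1r.
Qed.

(** Read from right to left, this presents a word with one altered letter as a
    plain product, the form in which freeness applies. *)
Lemma prod_subst_at n (f : 'I_n -> A) (c : A) (j : 'I_n) :
  \prod_(k < n) (if k == j then c else f k) =
  (\prod_(k < n | (k < j)%N) f k) * c * \prod_(k < n | (j < k)%N) f k.
Proof.
rewrite (prod_split_at _ _ j) eqxx; congr (_ * _ * _); apply: eq_bigr => k.
  by rewrite -val_eqE /=; case: ltngtP.
by rewrite -val_eqE /=; case: ltngtP.
Qed.

End SplitProducts.

Section UpperTriangularProducts.
Variables (K : fieldType) (A : algType K).

Lemma ut_diag_prod n (M : 'I_n -> utmx A) :
  ut_diag (\prod_(j < n) M j) = \prod_(j < n) ut_diag (M j).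
Proof. exact: (big_morph _ (@ut_diagM _ A) (@ut_diag1 _ A)). Qed.

(** The corner is a derivation over the diagonal, so only words with exactly one
    corner letter survive in the corner of a product. *)
Lemma ut_corner_prod n (M : 'I_n -> utmx A) :
  ut_corner (\prod_(j < n) M j) =
  \sum_(j < n) (\prod_(k < n | (k < j)%N) ut_diag (M k)) * ut_corner (M j)
               * \prod_(k < n | (j < k)%N) ut_diag (M k).
Proof.
elim: n => [|n IHn] in M *; first by rewrite !big_ord0 ut_corner1.
rewrite !big_ord_recl ut_cornerM ut_diag_prod IHn prod_before0 prod_after0.
rewrite mul1r addrC mulr_sumr; congr (_ + _); apply: eq_bigr => j _.
by rewrite prod_before_lift prod_after_lift !mulrA.
Qed.

End UpperTriangularProducts.

Section UpperTriangularFreeness.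
Variables (K : fieldType) (S : oviSpace K) (I : Type).
Variable Ai : I -> subalgOver S.

Local Notation E := (ov_exp S).
Local Notation E' := (ovi_exp' S).

Lemma ut_exp_eq0 (M : utmx S) :
  ut_exp E E' M = 0 <->
  E (ut_diag M) = 0 /\ E (ut_corner M) + E' (ut_diag M) = 0.
Proof.
have [d0 c0] : ut_diag (0 : utmx S) = 0 /\ ut_corner (0 : utmx S) = 0.
  by rewrite /ut_diag /ut_corner !mxE.
split=> [M0 | [dM cM]]; last by apply: ut_ext; rewrite !utE ?d0 ?c0.
by have := (congr1 (@ut_diag _ _) M0, congr1 (@ut_corner _ _) M0);
   rewrite !utE d0 c0 => -[].
Qed.

Lemma ut_exp_prod_eq0 n (M : 'I_n -> utmx S) :
  ut_exp E E' (\prod_(j < n) M j) = 0 <->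
  E (\prod_(j < n) ut_diag (M j)) = 0 /\
  \sum_(j < n) E ((\prod_(k < n | (k < j)%N) ut_diag (M k))
                  * ut_corner (M j)
                  * \prod_(k < n | (j < k)%N) ut_diag (M k))
  + E' (\prod_(j < n) ut_diag (M j)) = 0.
Proof. by rewrite ut_exp_eq0 ut_diag_prod ut_corner_prod linear_sum. Qed.

Lemma inf_free_ut_free :
  inf_free_family Ai ->
  free_family (S := upper_triangular S) (fun i => ut_subalg (Ai i)).
Proof.
move=> freeA n i M n_gt0 alt_i AM /(_ _)/ut_exp_eq0 M0.
pose a j := ut_diag (M j : utmx S).
have Aa j : a j \in subalg_set (Ai (i j)) by have /andP[] := AM j.
have Ea j : E (a j) = 0 by have [] := M0 j.
have [Eprod E'prod] := freeA n i a n_gt0 alt_i Aa Ea.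
pose c j := ut_corner (M j : utmx S) + E' (a j).
have Ac j : c j \in subalg_set (Ai (i j)).
  have /andP[_ cM] := AM j.
  by rewrite rpredD // subalg_over // ovi_exp'_base.
have Ec j : E (c j) = 0.
  rewrite linearD /= [E (E' _)]ov_exp_id ?ovi_exp'_base //.
  by have [] := M0 j.
apply/(ut_exp_prod_eq0 n M); split=> //.
rewrite E'prod -big_split big1 //= => j _.
rewrite -linearD /= -mulrDl -mulrDr -/(a _) -/(c j).
(* The altered word is still alternating and centered, so freeness kills it. *)
rewrite -prod_subst_at.
have [||] := freeA n i (fun k => if k == j then c j else a k) n_gt0 alt_i => //.
  by move=> k; case: eqP => [->|].
by move=> k; case: eqP.
Qed.

(** Centered [a_j] leave the corners free to choose; the corner [- E'(a_j)] works
    because [E] fixes the base, so that it cancels the [E'] part of the corner of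
    the triangular expectation. *)
Lemma ut_free_inf_free :
  free_family (S := upper_triangular S) (fun i => ut_subalg (Ai i)) ->
  inf_free_family Ai.
Proof.
move=> freeU n i a n_gt0 alt_i Aa Ea.
pose M j : utmx S := ut (a j) (- E' (a j)).
have AM j : M j \in ut_over (subalg_set (Ai (i j))).
  have A'j : - E' (a j) \in subalg_set (Ai (i j)).
    by rewrite subalg_over // -scaleN1r rpredZ ?ovi_exp'_base.
  by rewrite inE !utE; apply/andP; split; [apply: Aa | apply: A'j].
have M0 j : ut_exp E E' (M j) = 0.
  apply/ut_exp_eq0; rewrite !utE; split=> //.
  by rewrite linearN /= ov_exp_id ?ovi_exp'_base // addNr.
have diagM (P : pred 'I_n) :
    \prod_(k < n | P k) ut_diag (M k) = \prod_(k < n | P k) a k.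
  by apply: eq_bigr => k _; rewrite utE.
have /ut_exp_prod_eq0[] := freeU n i M n_gt0 alt_i AM M0.
rewrite !diagM addrC => -> /(canRL (addrK _)) E'prod; split=> //.
rewrite E'prod sub0r -sumrN; apply: eq_bigr => j _.
by rewrite !diagM utE mulrN mulNr linearN opprK.
Qed.

End UpperTriangularFreeness.

Theorem proposition3p3 (R : realType) (S : oviSpace R[i]) (I : Type)
    (Ai : I -> subalgOver S) :
  inf_free_family Ai <->
  free_family (S := upper_triangular S) (fun i => ut_subalg (Ai i)).
Proof. by split; [apply: inf_free_ut_free | apply: ut_free_inf_free]. Qed.
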